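(* Let $f:[0,\infty)\to\mathbb{R}$ be a function that is differentiable on $(0,\infty)$, let $0<a<b$, and suppose $f'\in L[a,b]$. Let $s\in(0,1]$ be fixed. If $|f'|$ is $s$-convex in the second sense on $[a,b]$, then $$\left|\frac{1}{b-a}\int_a^b f(x)\,dx-\frac12\left(\frac{b f(a)-a f(b)}{b-a}+f\left(\frac{a+b}{2}\right)\right)\right|$$ $$\le \frac{b\left(s2^{s+1}+s+2\right)+a\left(2^{s+2}-s-2\right)}{2^{s+2}(s+1)(s+2)}\,|f'(a)|+\frac{a\left(s2^{s+1}+s+2\right)+b\left(2^{s+2}-s-2\right)}{2^{s+2}(s+1)(s+2)}\,|f'(b)|.$$
   Context: For $s\in(0,1]$, a function $\varphi$ with values in $[0,\infty)$ is $s$-convex in the second sense on an interval $I\subseteq[0,\infty)$ if $\varphi(tx+(1-t)y)\le t^s\varphi(x)+(1-t)^s\varphi(y)$ for all $x,y\in I$ and all $t\in[0,1]$. $L[a,b]$ denotes the (Lebesgue) integrable functions on $[a,b]$. *)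

(* Defs.v *)
From HB Require Import structures.
From mathcomp Require Import all_boot all_order all_algebra.
From mathcomp Require Import all_classical all_reals all_analysis.
Import Order.TTheory GRing.Theory Num.Theory.
Import numFieldNormedType.Exports.

Set Implicit Arguments.
Unset Strict Implicit.
Unset Printing Implicit Defensive.

Local Open Scope ring_scope.

(* s-convexity in the second sense on the interval I. The notion is meant for
   0 < s <= 1 and I included in `[0, +oo[; in particular 0 `^ s = 0 there. *)
Definition s_convex2 (R : realType) (s : R) (I : interval R) (phi : R -> R) :=
  (forall x, x \in I -> 0 <= phi x) /\
  (forall x y t, x \in I -> y \in I -> 0 <= t <= 1 ->
    phi (t * x + (1 - t) * y) <= t `^ s * phi x + (1 - t) `^ s * phi y).

(* Main.v *)
Require Import Defs.
From HB Require Import structures.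
From mathcomp Require Import all_boot all_order all_algebra.
From mathcomp Require Import all_classical all_reals all_analysis.
From mathcomp Require Import ring lra.
Import Order.TTheory GRing.Theory Num.Theory.
Import numFieldNormedType.Exports.

Set Implicit Arguments.
Unset Strict Implicit.
Unset Printing Implicit Defensive.

Local Open Scope classical_set_scope.
Local Open Scope ring_scope.


(** Let m = (a + b) / 2. Take the kernel p with slope 1 on each half of [a, b],
    p(x) = x - (a + b / 2) on [a, m] and p(x) = x - (b + a / 2) on [m, b].
    The two offsets are forced: the boundary terms of an integration by parts
    on the two halves then turn (b - a) times the quantity to be estimated into
    minus the integral of p f'. Moreover p is nonpositive on both halves, and
    s-convexity bounds |f'| by the chord
      g(x) = t^s |f'(b)| + (1 - t)^s |f'(a)|,  where t = (x - a) / (b - a),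
    so the estimate is the integral of |p| g, whose value is the right-hand
    side multiplied by b - a.

    The comparison is carried out on primitives. On each half, p = x - c and
    Phi(x) = (x - c) f(x) - int_a^x f has derivative p f', which is dominated by
    (c - x) g(x), the derivative of an explicit combination of powers
    (majorant, is_derive_majorant). The mean value theorem
    (normB_le_of_derive_le) then bounds the increments of Phi by those of the
    majorant (kernel_estimate). Adding the two halves, whose endpoints
    correspond to t = 0, 1/2 and 1, leaves an identity between rational
    functions of a, b, s and 2^(s + 1). *)

(** The mean value theorem applied to H - F and to H + F, whose derivatives are
    nonnegative: no integral of the derivatives enters. *)
Lemma normB_le_of_derive_le (R : realType) (F H dF dH : R -> R) (u v : R) :
  u <= v ->
  {within `[u, v], continuous F} -> {within `[u, v], continuous H} ->
  (forall x, u < x < v -> is_derive x 1 F (dF x)) ->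
  (forall x, u < x < v -> is_derive x 1 H (dH x)) ->
  (forall x, u < x < v -> `|dF x| <= dH x) ->
  `|F v - F u| <= H v - H u.
Proof.
rewrite le_eqVlt => /predU1P[->|uv]; first by rewrite !subrr normr0.
move=> cF cH FdF HdH dFH.
have mono (e : R) : `|e| = 1 -> e * (F v - F u) <= H v - H u.
  move=> e1; pose D := H - e \*: F.
  have dD x : x \in `]u, v[ -> is_derive x 1 D (dH x - e *: dF x).
    rewrite in_itv => /= xuv.
    have := FdF x xuv; have := HdH x xuv => ? ?.
    exact: is_deriveB.
  have cD : {within `[u, v], continuous D}.
    apply/subspace_continuousP => x xuv; apply: cvgB.
      by move/subspace_continuousP : cH; exact.
    apply: cvgZr.
    by move/subspace_continuousP : cF; exact.
  have [c] := MVT uv dD cD.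
  rewrite in_itv => /= cuv DE.
  suff : 0 <= D v - D u by rewrite /D /GRing.sub_fun /= !fctE /= /GRing.scale /=; lra.
  rewrite DE mulr_ge0 ?subr_ge0 ?(ltW uv)//.
  by rewrite (le_trans _ (dFH c cuv))// (le_trans (ler_norm _))// normrM e1 mul1r.
rewrite ler_norml; apply/andP; split.
  by rewrite lerNl -mulN1r mono// normrN1.
by rewrite -[leLHS]mul1r mono// normr1.
Qed.

(** Inserting the absolute value makes the power function continuous on the
    whole line: x `^ p is 1 for x < 0, so it jumps at 0 from the left. *)
Lemma continuous_normr_powR (R : realType) (p : R) : 1 <= p ->
  continuous (fun t : R => `|t| `^ p).
Proof.
move=> p1 t; have p0 : 0 < p by rewrite (lt_le_trans _ p1).
have [->|t0] := eqVneq t 0.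
  rewrite /continuous_at normr0 powR0 ?gt_eqF//.
  (* for |t| <= 1 and p >= 1, |t|^p lies between 0 and |t| *)
  apply: (@squeeze_cvgr _ _ _ _ (fun=> 0) (fun t : R => `|t|)).
  - near=> x; rewrite powR_ge0/=.
    have [->|x0] := eqVneq x 0; first by rewrite normr0 powR0 ?gt_eqF.
    apply: ge1r_powR => //; rewrite normr_gt0 x0/=.
    near: x; exact: (@nbhs0_le _ R^o _ ltr01).
  - exact: cvg_cst.
  - rewrite -[X in _ --> X](@normr0 R R); exact: norm_continuous.
have pc : {for `|t|, continuous (fun y : R => y `^ p)}.
  apply: differentiable_continuous; apply/derivable1_diffP.
  by apply: derivable_powR; rewrite in_itv/= andbT normr_gt0.
apply: (@continuous_comp _ _ _ (fun y : R => `|y|) (fun y => y `^ p)) => //.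
exact: norm_continuous.
Unshelve. all: by end_near. Qed.

Lemma is_derive_normr_powR (R : realType) (p y : R) : 0 < y ->
  is_derive y 1 (fun t : R => `|t| `^ p) (p * y `^ (p - 1)).
Proof.
move=> y0; have d := @is_derive1_powR R p y y0.
apply: (near_eq_is_derive _ d).
near=> t; rewrite ger0_norm//; apply: ltW; near: t; exact: lt_nbhsr.
Unshelve. all: by end_near. Qed.

(** On y > 0, the primitive of (k - e y) y^s that vanishes at 0; a linear weight
    times a power is the only kind of integrand that arises here. *)
Definition powR_primitive (R : realType) (s k e y : R) : R :=
  k / (s + 1) * `|y| `^ (s + 1) - e / (s + 2) * `|y| `^ (s + 2).

Lemma continuous_powR_primitive (R : realType) (s k e : R) : 0 <= s ->
  continuous (powR_primitive s k e).
Proof.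
move=> s0 y; apply: cvgB; (apply: cvgM; first exact: cvg_cst);
  apply: continuous_normr_powR; lra.
Qed.

Lemma is_derive_powR_primitive (R : realType) (s k e y : R) : 0 <= s -> 0 < y ->
  is_derive y 1 (powR_primitive s k e) ((k - e * y) * y `^ s).
Proof.
move=> s0 y0.
have d1 := is_derive_normr_powR (s + 1) y0.
have d2 := is_derive_normr_powR (s + 2) y0.
rewrite (_ : powR_primitive s k e =
  (k / (s + 1)) \*: (fun t : R => `|t| `^ (s + 1)) -
  (e / (s + 2)) \*: (fun t : R => `|t| `^ (s + 2))) //.
apply: is_derive_eq.
rewrite /GRing.scale /= addrK (_ : s + 2 - 1 = s + 1); last by ring.
have -> : y `^ (s + 1) = y * y `^ s.
  by rewrite powRD ?powRr1 1?mulrC ?ltW// (gt_eqF y0) implybT.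
by field; apply/andP; split; apply: lt0r_neq0; lra.
Qed.

(** A primitive of (c - x) g(x), where g is the chord with values A at a and B
    at b. In the variable t = (x - a) / (b - a) the weight c - x is
    (c - a) - (b - a) t, and in r = (b - x) / (b - a) it is
    (c - b) - (a - b) r; the minus sign before the second summand comes from
    r decreasing in x. *)
Definition majorant (R : realType) (a b s A B c x : R) : R :=
  (b - a) * B * powR_primitive s (c - a) (b - a) ((x - a) / (b - a))
  - (b - a) * A * powR_primitive s (c - b) (a - b) ((b - x) / (b - a)).

Lemma continuous_majorant (R : realType) (a b s A B c : R) : 0 <= s ->
  continuous (majorant a b s A B c).
Proof.
move=> s0 x; apply: cvgB; (apply: cvgM; first exact: cvg_cst).
  apply: (@continuous_comp _ _ _ (fun x => (x - a) / (b - a))).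
    by apply: cvgM; [apply: cvgB; [exact: cvg_id|exact: cvg_cst]|exact: cvg_cst].
  exact: continuous_powR_primitive.
apply: (@continuous_comp _ _ _ (fun x => (b - x) / (b - a))).
  by apply: cvgM; [apply: cvgB; [exact: cvg_cst|exact: cvg_id]|exact: cvg_cst].
exact: continuous_powR_primitive.
Qed.

Lemma is_derive_majorant (R : realType) (a b s A B c x : R) :
  0 <= s -> a < x < b ->
  is_derive x 1 (majorant a b s A B c)
    ((c - x) * (((x - a) / (b - a)) `^ s * B + ((b - x) / (b - a)) `^ s * A)).
Proof.
move=> s0 /andP[ax xb].
have ba0 : 0 < b - a by lra.
have dt : is_derive x 1 (fun y : R => (y - a) / (b - a)) (b - a)^-1.
  rewrite (_ : (fun y : R => _) = (b - a)^-1 \*: (id - cst a)); last first.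
    by apply/funext => y; rewrite /= mulrC.
  by apply: is_derive_eq; rewrite /GRing.scale /= subr0 mulr1.
have dr : is_derive x 1 (fun y : R => (b - y) / (b - a)) (- (b - a)^-1).
  rewrite (_ : (fun y : R => _) = (b - a)^-1 \*: (cst b - id)); last first.
    by apply/funext => y; rewrite /= mulrC.
  by apply: is_derive_eq; rewrite /GRing.scale /= sub0r mulrN1.
have dP := @is_derive_powR_primitive R s (c - a) (b - a) ((x - a) / (b - a)) s0.
have dQ := @is_derive_powR_primitive R s (c - b) (a - b) ((b - x) / (b - a)) s0.
have {}dP := dP (divr_gt0 (ltac:(lra) : 0 < x - a) ba0).
have {}dQ := dQ (divr_gt0 (ltac:(lra) : 0 < b - x) ba0).
have d1 := is_derive1_comp (g := fun y => (y - a) / (b - a)) dP dt.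
have d2 := is_derive1_comp (g := fun y => (b - y) / (b - a)) dQ dr.
have := is_deriveB (is_deriveZ ((b - a) * B) d1) (is_deriveZ ((b - a) * A) d2).
move=> /is_derive_eq; apply; rewrite /GRing.scale /=.
by field; exact: lt0r_neq0.
Qed.

(** This is the convexity inequality with weight t = (x - a) / (b - a), because
    x = t b + (1 - t) a. *)
Lemma norm_le_chord (R : realType) (g : R -> R) (a b s x : R) :
  a < b -> s_convex2 s `[a, b] (fun x => `|g x|) -> a <= x <= b ->
  `|g x| <= ((x - a) / (b - a)) `^ s * `|g b| + ((b - x) / (b - a)) `^ s * `|g a|.
Proof.
move=> ab [_ cvx] /andP[ax xb]; have ba0 : 0 < b - a by lra.
have -> : (b - x) / (b - a) = 1 - (x - a) / (b - a) by field; exact: lt0r_neq0.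
rewrite [in leLHS](_ : x = (x - a) / (b - a) * b + (1 - (x - a) / (b - a)) * a).
  apply: cvx; rewrite ?in_itv/= ?lexx ?(ltW ab)//.
  by rewrite divr_ge0 ?ler_pdivrMr//=; lra.
by field; exact: lt0r_neq0.
Qed.

(** The derivative is (x - c) f'(x): the two terms f(x) cancel, as in an
    integration by parts. *)
Definition kernel_primitive (R : realType) (f : R -> R) (a c x : R) : R :=
  (x - c) * f x - parameterized_integral (@lebesgue_measure R) a x f.

(** The condition v <= c gives the kernel x - c a constant sign on [u, v], so
    that its absolute value c - x is the weight in the derivative of the
    majorant. *)
Lemma kernel_estimate (R : realType) (f : R -> R) (a b s c u v : R) :
  a < b -> 0 <= s -> {in `[a, b], forall x, derivable f x 1} ->
  s_convex2 s `[a, b] (fun x => `|derive1 f x|) ->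
  a <= u -> u <= v -> v <= b -> v <= c ->
  `|kernel_primitive f a c v - kernel_primitive f a c u| <=
  majorant a b s `|derive1 f a| `|derive1 f b| c v -
  majorant a b s `|derive1 f a| `|derive1 f b| c u.
Proof.
move=> ab s0 fd cvx au uv vb vc.
have cf : {within `[a, b], continuous f} by exact: derivable_within_continuous.
have intf : (@lebesgue_measure R).-integrable `[a, b] (EFin \o f).
  by apply: continuous_compact_integrable => //; exact: segment_compact.
have uvab : `[u, v] `<=` `[a, b] by apply: subset_itv; rewrite bnd_simp.
apply: (@normB_le_of_derive_le _ (kernel_primitive f a c)
  (majorant a b s `|derive1 f a| `|derive1 f b| c)
  (fun x => (x - c) * derive1 f x)
  (fun x => (c - x) * (((x - a) / (b - a)) `^ s * `|derive1 f b|
                      + ((b - x) / (b - a)) `^ s * `|derive1 f a|)) _ _ uv).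
- apply: (continuous_subspaceW uvab).
  apply/subspace_continuousP => x xab; apply: cvgB; first apply: cvgM.
  + apply: cvgB; last exact: cvg_cst.
    exact: cvg_within.
  + by move/subspace_continuousP : cf; exact.
  + move: (parameterized_integral_continuous (ltW ab) intf).
    by move=> /subspace_continuousP; exact.
- by apply: continuous_subspaceT; exact: continuous_majorant.
- move=> x /andP[ux xv].
  have [ax xb] : a < x /\ x < b by split; lra.
  have fdx : derivable f x 1 by apply: fd; rewrite in_itv/= !ltW.
  have cfx : {for x, continuous f}.
    by apply: differentiable_continuous; apply/derivable1_diffP.
  have [dI IE] := continuous_FTC1_closed xb intf ax cfx.
  have dfx : is_derive x 1 f (derive1 f x) by rewrite derive1E; exact: derivableP.
  have dIx : is_derive x 1
      (fun x => parameterized_integral (@lebesgue_measure R) a x f) (f x).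
    by rewrite -IE derive1E; exact: derivableP.
  have dp : is_derive x 1 (id - cst c) (1 - 0) by apply: is_deriveB.
  have := is_deriveB (is_deriveM dp dfx) dIx.
  move=> /is_derive_eq; apply; rewrite /GRing.scale /=.
  rewrite (_ : (id - cst c) x = x - c)//; ring.
- by move=> x /andP[ux xv]; apply: is_derive_majorant => //; apply/andP; split; lra.
- move=> x /andP[ux xv]; rewrite normrM distrC (@ger0_norm _ (c - x)); last lra.
  by apply: ler_wpM2l; [lra|apply: norm_le_chord => //; lra].
Qed.

Theorem theorem10 (R : realType) (f : R -> R) (a b s : R)
  (f_diff : forall x : R, 0 < x -> derivable f x 1)
  (a_gt0 : 0 < a) (a_lt_b : a < b)
  (f'_int : (@lebesgue_measure R).-integrable `[a, b] (EFin \o derive1 f))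
  (s_gt0 : 0 < s) (s_le1 : s <= 1)
  (f'_conv : s_convex2 s `[a, b] (fun x => `|derive1 f x|)) :
  `| (b - a)^-1 * (\int[@lebesgue_measure R]_(x in `[a, b]) f x)%R
     - 2^-1 * ((b * f a - a * f b) / (b - a) + f ((a + b) / 2)) |
  <= (b * (s * 2 `^ (s + 1) + s + 2) + a * (2 `^ (s + 2) - s - 2))
       / (2 `^ (s + 2) * (s + 1) * (s + 2)) * `|derive1 f a|
     + (a * (s * 2 `^ (s + 1) + s + 2) + b * (2 `^ (s + 2) - s - 2))
       / (2 `^ (s + 2) * (s + 1) * (s + 2)) * `|derive1 f b|.
Proof.
have [ba0 s1 s2] : [/\ 0 < b - a, s + 1 != 0 & s + 2 != 0].
  by split; [lra|apply: lt0r_neq0; lra..].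
set m := (a + b) / 2.
have fd : {in `[a, b], forall x, derivable f x 1}.
  by move=> x; rewrite in_itv/= => /andP[ax _]; apply: f_diff; lra.
have am : a <= m by rewrite /m; lra.
have mb : m <= b by rewrite /m; lra.
have left_half := @kernel_estimate R f a b s (a + b / 2) a m a_lt_b (ltW s_gt0)
  fd f'_conv (lexx a) am mb (ltac:(rewrite /m; lra)).
have right_half := @kernel_estimate R f a b s (b + a / 2) m b a_lt_b (ltW s_gt0)
  fd f'_conv am mb (lexx b) (ltac:(lra)).
have := le_trans (ler_normD _ _) (lerD left_half right_half).
rewrite {left_half right_half} /kernel_primitive.
have -> : parameterized_integral lebesgue_measure a a f = 0.
  by rewrite /parameterized_integral set_itv1 Rintegral_set1.
rewrite -/(parameterized_integral lebesgue_measure a b f).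
set I := parameterized_integral _ _ b _.
set J := parameterized_integral _ _ m _.
set A := `|derive1 f a|; set B := `|derive1 f b|.
set E := (X in _ -> `|X| <= _).
set F := (X in `|X| <= _ -> _).
(* the integrals over [a, m] cancel, and the offsets of the two kernels
   produce exactly the coefficients of f a, f m and f b in E *)
have -> : F = - (b - a) * E.
  by rewrite /F /E /m; field; exact: lt0r_neq0.
rewrite normrM normrN (gtr0_norm ba0) mulrC -ler_pdivlMr//.
move=> /le_trans; apply.
rewrite /majorant /powR_primitive.
have -> : (a - a) / (b - a) = 0 by rewrite subrr mul0r.
have -> : (b - b) / (b - a) = 0 by rewrite subrr mul0r.
have -> : (b - a) / (b - a) = 1 by rewrite divff// lt0r_neq0.
have -> : (m - a) / (b - a) = 2^-1 by rewrite /m; field; exact: lt0r_neq0.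
have -> : (b - m) / (b - a) = 2^-1 by rewrite /m; field; exact: lt0r_neq0.
rewrite normr0 normr1 !powR1 !powR0// ger0_norm; last by rewrite invr_ge0.
(* every power left is one of 0, 1, 1/2 or 2; all are expressed by 2^(s + 1) *)
have hp p : (2^-1 : R) `^ p = (2 `^ p)^-1 by rewrite -powR_inv1// -!powRrM mulN1r powRN.
rewrite !hp.
have -> : 2 `^ (s + 2) = 2 * 2 `^ (s + 1) :> R.
  rewrite (_ : s + 2 = 1 + (s + 1)); last by ring.
  by rewrite (@powRD _ 2 1) ?powRr1 ?pnatr_eq0 ?implybT.
have Q0 : 2 `^ (s + 1) != 0 :> R by rewrite lt0r_neq0// powR_gt0.
rewrite le_eqVlt; apply/orP; left; apply/eqP.
by field; rewrite s1 s2 Q0 lt0r_neq0.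
Qed.
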